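(* Let $(E,\|\cdot\|)$ be a normed linear space over $\mathbb{K}$ ($\mathbb{K}=\mathbb{R}$ or $\mathbb{C}$), with dual space $E^{*}$, and let $n\ge 1$. For any $\mathbf{x}=(x_1,\dots,x_n)\in E^n$ we have $$\|\mathbf{x}\|_{h,n,q}=\sup_{f\in E^*,\ \|f\|\le 1}\left(\sum_{j=1}^n |f(x_j)|^q\right)^{1/q}$$ whenever $p,q>1$ with $\frac1p+\frac1q=1$, $$\|\mathbf{x}\|_{h,n,1}=\sup_{f\in E^*,\ \|f\|\le 1}\ \sum_{j=1}^n |f(x_j)|,$$ and $$\|\mathbf{x}\|_{h,n,\infty}=\|\mathbf{x}\|_{n,\infty}=\max_{j\in\{1,\dots,n\}}\|x_j\|.$$ In particular, $$\|\mathbf{x}\|_{h,e}=\sup_{f\in E^*,\ \|f\|\le 1}\left(\sum_{j=1}^n |f(x_j)|^2\right)^{1/2}.$$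
   Context: $E^*$ is the space of bounded linear functionals on $E$, with norm $\|f\|=\sup_{\|x\|\le 1}|f(x)|$. For $p\in[1,\infty]$ let $\mathbb{B}_{n,p}=\{\lambda=(\lambda_1,\dots,\lambda_n)\in\mathbb{K}^n : \|\lambda\|_{n,p}\le 1\}$, where $\|\lambda\|_{n,p}=(\sum_{k=1}^n|\lambda_k|^p)^{1/p}$ for $p<\infty$ and $\|\lambda\|_{n,\infty}=\max_k|\lambda_k|$. The hypo-$q$-norm on $E^n$ is $$\|\mathbf{x}\|_{h,n,q}:=\sup_{\lambda\in\mathbb{B}_{n,p}}\left\|\sum_{j=1}^n\lambda_jx_j\right\|,$$ where $p$ is the conjugate exponent of $q$: $\frac1p+\frac1q=1$ if $p,q>1$ are finite; $q=1$ if $p=\infty$; $q=\infty$ if $p=1$. The hypo-Euclidean norm is $\|\mathbf{x}\|_{h,e}:=\|\mathbf{x}\|_{h,n,2}$. $\|\mathbf{x}\|_{n,\infty}:=\max_{j}\|x_j\|$ for $\mathbf{x}\in E^n$. *)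

(* Defs.v *)
From HB Require Import structures.
From mathcomp Require Import all_boot all_order all_algebra.
From mathcomp Require Import complex.
From mathcomp Require Import all_classical all_reals all_analysis.

Set Implicit Arguments.
Unset Strict Implicit.
Unset Printing Implicit Defensive.

Import Order.TTheory GRing.Theory Num.Theory.
Import numFieldNormedType.Exports.

Local Open Scope classical_set_scope.
Local Open Scope ring_scope.

Variant scalar_kind := real_scalars | complex_scalars.

Definition scalar_field (R : realType) (k : scalar_kind) : numFieldType :=
  match k with
  | real_scalars => R
  | complex_scalars => R[i]
  end.

Definition real_part (R : realType) (k : scalar_kind) :
    scalar_field R k -> R :=
  match k with
  | real_scalars => fun z => z
  | complex_scalars => fun z => complex.Re z
  end.

(* The norm of a normed space over K takes its values in K, where it is a     *)
(* nonnegative real; [rnorm] is the same number as an element of R. It applies *)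
(* to vectors and, K being normed over itself, to scalars.                    *)
Definition rnorm (R : realType) (k : scalar_kind)
    (V : normedZmodType (scalar_field R k)) (v : V) : R :=
  real_part `|v|.

Section HypoNorms.
Context (R : realType) (k : scalar_kind).
Local Notation K := (scalar_field R k).

(* For p = +oo, the default value 0 of the maximum is harmless: the terms are *)
(* nonnegative. The value at -oo is never used.                               *)
Definition lp_norm (n : nat) (p : \bar R) (lambda : 'I_n -> K) : R :=
  match p with
  | r%:E => (\sum_(j < n) rnorm (lambda j) `^ r) `^ r^-1
  | +oo%E => \big[Num.max/0]_(j < n) rnorm (lambda j)
  | -oo%E => 0
  end.

Definition lp_ball (n : nat) (p : \bar R) : set ('I_n -> K) :=
  [set lambda | lp_norm p lambda <= 1].

Variable E : normedModType K.

(* [hoelder_conjugate] exchanges 1 and +oo, and maps a real q > 1 to          *)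
(* q / (q - 1). For 1 <= q the set below is nonempty and bounded: every       *)
(* lambda in the ball has coordinates of modulus at most 1.                   *)
Definition hypo_norm (n : nat) (q : \bar R) (x : 'I_n -> E) : R :=
  sup [set rnorm (\sum_(j < n) lambda j *: x j) |
        lambda in lp_ball (hoelder_conjugate q)].

Definition hypo_euclidean_norm (n : nat) (x : 'I_n -> E) : R :=
  hypo_norm 2%:E x.

Definition max_norm (n : nat) (x : 'I_n -> E) : R :=
  \big[Num.max/0]_(j < n) rnorm (x j).

Definition dual_space : set {scalar E} :=
  [set f : {scalar E} | exists M : R, forall v : E, rnorm (f v) <= M * rnorm v].

(* Meaningful for f in [dual_space] only: [sup] is 0 on unbounded sets.       *)
Definition dual_norm (f : {scalar E}) : R :=
  sup [set rnorm (f v) | v in [set v : E | rnorm v <= 1]].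

Definition dual_unit_ball : set {scalar E} :=
  [set f : {scalar E} | dual_space f /\ dual_norm f <= 1].

End HypoNorms.

Arguments dual_unit_ball {R k} E.

(* Main.v *)
(* Both suprema equal the supremum of |sum_j lambda_j f(x_j)| over lambda in   *)
(* the p-ball and f in the dual unit ball. Maximising first over f, a norming  *)
(* functional of sum_j lambda_j x_j gives the hypo-q-norm; maximising first    *)
(* over lambda, the extremal case of Hoelder's inequality gives the right-hand *)
(* side. Norming functionals come from the Hahn-Banach theorem, proved without *)
(* partial functionals: by Zorn's lemma, there is a minimal sublinear          *)
(* functional below any sublinear one, and minimal ones are linear.            *)

Require Import Defs.
From HB Require Import structures.
From mathcomp Require Import all_boot all_order all_algebra.
From mathcomp Require Import complex ring lra.
From mathcomp Require Import all_classical all_reals all_analysis.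

Set Implicit Arguments.
Unset Strict Implicit.
Unset Printing Implicit Defensive.

Import Order.TTheory GRing.Theory Num.Theory.
Import numFieldNormedType.Exports.

Local Open Scope classical_set_scope.
Local Open Scope ring_scope.

(** The formulas with a supremum over functionals are instances of [hypo_norm_dual], which needs a
    function N on K^n such that N z is the maximum of |sum_j lambda_j z_j| over the ball of the
    conjugate exponent. There [norming_functional] replaces the norm of a vector v by |f v| for some
    f in the dual unit ball. For finite q > 1, N comes from [lp_hoelder] and [lp_hoelder_extremal];
    for q = 1 it is the sum of moduli, attained by choosing phases. For q = +oo the ball is that of
    l^1, and the triangle inequality and the unit coordinate vectors give the maximum directly. *)

(** * Hahn-Banach through minimal sublinear functionals *)

Section Sublinear.
Variables (R : realType) (K : nzRingType) (iota : {rmorphism R -> K}).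
Variable V : lmodType K.
Implicit Types (p q : V -> R) (x y v : V).

(** Homogeneity is asked as an inequality because that form passes easily to infima; [sublinearZ]
    recovers equality by applying it to t and to its inverse. Only real scalars enter, through
    [iota]. *)
Definition sublinear p :=
  (forall x y, p (x + y) <= p x + p y) /\
  (forall t x, 0 <= t -> p (iota t *: x) <= t * p x).

Lemma sublinearZ p t x : sublinear p -> 0 <= t -> p (iota t *: x) = t * p x.
Proof.
move=> [pD pZ]; rewrite le_eqVlt => /predU1P[<-|t0].
  rewrite rmorph0 scale0r mul0r; apply/le_anti/andP; split.
    by have := pZ 0 0 (lexx _); rewrite scaler0 mul0r.
  by have := pD 0 0; rewrite addr0 lerDl.
apply/le_anti; rewrite pZ ?(ltW t0)//=.
have := pZ t^-1 (iota t *: x); rewrite invr_ge0 ltW// => /(_ isT).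
by rewrite scalerA -rmorphM mulVf ?gt_eqF// rmorph1 scale1r ler_pdivlMl.
Qed.

Lemma sublinear0 p : sublinear p -> p 0 = 0.
Proof.
by move=> sp; rewrite -(scale0r 0) -(rmorph0 iota) sublinearZ// mul0r.
Qed.

Lemma sublinear_geN p x : sublinear p -> - p (- x) <= p x.
Proof. by move=> sp; rewrite lerNl -subr_ge0 opprK -(sublinear0 sp) -(addNr x) sp.1. Qed.

(* If p is minimal then p = shrink p y <= p, and the term t = 1 of the infimum *)
(* gives p x + p y <= p (x + y).                                              *)
Definition shrink p y x : R :=
  inf [set p (x + iota t *: y) - t * p y | t in [set t : R | 0 <= t]].

Section Shrink.
Variables (p : V -> R) (y : V).
Hypothesis sp : sublinear p.

Lemma shrink_le x t : 0 <= t -> shrink p y x <= p (x + iota t *: y) - t * p y.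
Proof.
move=> t0; apply: ge_inf; last by exists t.
(* The infimum is finite: s p(y) = p(s y) <= p(x + s y) + p(-x). *)
exists (- p (- x)) => _ [s s0 <-].
rewrite lerNl opprB lerBlDr addrC -(sublinearZ y sp s0).
by apply: le_trans (sp.1 _ _); rewrite addrC addKr.
Qed.

Lemma le_shrink x m :
  (forall t, 0 <= t -> m <= p (x + iota t *: y) - t * p y) -> m <= shrink p y x.
Proof.
move=> mp; apply: lb_le_inf => [|_ [t t0 <-]]; last exact: mp.
by exists (p (x + iota 0 *: y) - 0 * p y), 0 => //=.
Qed.

Lemma shrink_le_self x : shrink p y x <= p x.
Proof.
by have := shrink_le x (lexx 0); rewrite rmorph0 scale0r addr0 mul0r subr0.
Qed.

(** Parameters t for x and s for x' combine into t + s for x + x'; a parameter s for x becomes c s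
    for c x. The case c = 0 is apart, since the infimum is reached by dividing by c. *)
Lemma shrink_sublinear : sublinear (shrink p y).
Proof.
split=> [x x'|c x c0].
  rewrite -lerBlDr; apply: le_shrink => t t0.
  rewrite lerBlDl -lerBlDr; apply: le_shrink => s s0.
  rewrite lerBlDr; apply: le_trans (shrink_le _ (addr_ge0 t0 s0)) _.
  rewrite mulrDl rmorphD/= scalerDl [X in p X]addrACA.
  by have := sp.1 (x + iota t *: y) (x' + iota s *: y); lra.
have shrink_cx s : 0 <= s ->
    shrink p y (iota c *: x) <= c * (p (x + iota s *: y) - s * p y).
  move=> s0; apply: le_trans (shrink_le _ (mulr_ge0 c0 s0)) _.
  by rewrite rmorphM -scalerA -scalerDr (sublinearZ _ sp c0) mulrBr mulrA.
move: c0; rewrite le_eqVlt => /predU1P[c0|c0].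
  by have := shrink_cx 0 (lexx 0); rewrite -c0 !mul0r.
by rewrite -ler_pdivrMl//; apply: le_shrink => t t0; rewrite ler_pdivrMl ?shrink_cx.
Qed.

End Shrink.

Definition minimal_sublinear p :=
  sublinear p /\ forall q, sublinear q -> (forall x, q x <= p x) -> q = p.

Lemma minimal_sublinear_additive p x y :
  minimal_sublinear p -> p (x + y) = p x + p y.
Proof.
move=> [sp pmin]; apply/le_anti; rewrite sp.1/=.
have <- := pmin _ (shrink_sublinear y sp) (shrink_le_self y sp).
rewrite -lerBrDr.
have := shrink_le y sp x ler01; rewrite rmorph1 scale1r mul1r => /le_trans; apply.
by rewrite (pmin _ (shrink_sublinear y sp) (shrink_le_self y sp)).
Qed.

Lemma minimal_sublinearZ p t x :
  minimal_sublinear p -> p (iota t *: x) = t * p x.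
Proof.
move=> pm; have sp := pm.1; have [t0|t0] := leP 0 t; first exact: sublinearZ.
(* For t < 0, additivity on t x and (-t) x, whose sum is 0, reduces to the factor -t. *)
have t0' : 0 <= - t by rewrite oppr_ge0 ltW.
apply/eqP; rewrite -subr_eq0 -mulNr -(sublinearZ _ sp t0').
by rewrite -minimal_sublinear_additive// -scalerDl -rmorphD subrr rmorph0 scale0r sublinear0.
Qed.

Lemma exists_minimal_sublinear q :
  sublinear q -> exists2 p, minimal_sublinear p & forall x, p x <= q x.
Proof.
move=> sq; pose T := {p : V -> R | sublinear p /\ forall x, p x <= q x}.
(* The order is reversed, so that a maximal element for Zorn is a minimal functional. *)
pose above (a b : T) := `[< forall x, sval b x <= sval a x >].
have [|r s t|[s ?] [t ?]||] := @Zorn T above.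
- by move=> a; apply/asboolP.
- by move=> /asboolP rs /asboolP st; apply/asboolP => x; apply: le_trans (rs x).
- move=> /asboolP st /asboolP ts; apply: eq_exist; apply/funext => x.
  by apply/le_anti; rewrite (st x) (ts x).
(* A nonempty chain is bounded by its pointwise infimum, finite because every member is at least
   -q(-x); the empty chain is bounded by q. *)
- move=> A Atot; have [->|/set0P[a0 Aa0]] := eqVneq A set0.
    by exists (exist _ q (conj sq (fun=> lexx _))).
  pose m x := inf [set sval a x | a in A].
  have m_le a x : A a -> m x <= sval a x.
    move=> Aa; apply: ge_inf; last by exists a.
    exists (- q (- x)) => _ [b Ab <-]; have [sb bq] := svalP b.
    by apply: le_trans (sublinear_geN x sb); rewrite lerN2.
  have le_m c x : (forall a, A a -> c <= sval a x) -> c <= m x.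
    by move=> cA; apply: lb_le_inf => [|_ [a Aa <-]]; [exists (sval a0 x), a0|exact: cA].
  have sm : sublinear m.
    split=> [x y|t x t0].
      rewrite -lerBlDr; apply: (le_m) => a Aa; rewrite lerBlDl -lerBlDr.
      apply: (le_m) => b Ab; rewrite lerBlDr.
      (* The smaller of the two members serves for both x and y, and its own subadditivity
         concludes. *)
      have [/asboolP ab|/asboolP ba] := Atot _ _ Aa Ab.
        apply: le_trans (m_le _ _ Ab) _; apply: le_trans ((svalP b).1.1 _ _) _.
        by rewrite addrC lerD2l ab.
      apply: le_trans (m_le _ _ Aa) _; apply: le_trans ((svalP a).1.1 _ _) _.
      by rewrite addrC lerD2r ba.
    have m_tx a : A a -> m (iota t *: x) <= t * sval a x.
      by move=> Aa; rewrite -(sublinearZ _ (svalP a).1 t0) m_le.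
    move: t0; rewrite le_eqVlt => /predU1P[t0|t0].
      by have := m_tx _ Aa0; rewrite -t0 !mul0r.
    by rewrite -ler_pdivrMl//; apply: (le_m) => a Aa; rewrite ler_pdivrMl ?m_tx.
  have mq x : m x <= q x by apply: le_trans (m_le _ _ Aa0) _; exact: (svalP a0).2.
  exists (exist _ m (conj sm mq)) => a Aa.
  by apply/asboolP => x /=; exact: m_le.
- move=> [p [sp pq]] pmax; exists p => //; split=> // r sr rp.
  have rq x : r x <= q x := le_trans (rp x) (pq x).
  by have /(congr1 sval) := pmax (exist _ r (conj sr rq)) (introT (asboolP _) rp).
Qed.

(** Taking u minimal below [shrink p v], rather than below p, forces equality at v: the term t = 1
    at -v gives u(-v) <= p(0) - p(v) = -p(v). *)
Theorem hahn_banach_sublinear p v : sublinear p ->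
  exists u : V -> R, [/\ forall x y, u (x + y) = u x + u y,
    forall t x, u (iota t *: x) = t * u x, forall x, u x <= p x & u v = p v].
Proof.
move=> sp; have [u um up] := exists_minimal_sublinear (shrink_sublinear v sp).
exists u; split.
- by move=> x y; exact: minimal_sublinear_additive.
- by move=> t x; exact: minimal_sublinearZ.
- by move=> x; exact: le_trans (up x) (shrink_le_self _ sp _).
- apply/le_anti; rewrite (le_trans (up v) (shrink_le_self _ sp _))/=.
  have := le_trans (up (- v)) (shrink_le v sp (- v) ler01).
  rewrite rmorph1 scale1r addNr sublinear0// mul1r sub0r.
  by rewrite -scaleN1r -(rmorphN1 iota) minimal_sublinearZ// mulN1r lerN2.
Qed.

End Sublinear.

Lemma scalar_of_additive_scalable (K : nzRingType) (E : lmodType K) (f : E -> K) :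
  (forall x y, f (x + y) = f x + f y) -> (forall a x, f (a *: x) = a * f x) ->
  exists F : {scalar E}, forall x, F x = f x.
Proof.
move=> fD fZ.
have flin : linear_for *%R f by move=> a x y; rewrite fD fZ.
pose L := GRing.isLinear.Build K E K *%R f flin.
pose F : {scalar E} := HB.pack f L.
by exists F.
Qed.

(** * Real and complex scalars treated uniformly *)

Section Scalars.
Variables (R : realType) (k : scalar_kind).
Local Notation K := (scalar_field R k).

Definition embed : {rmorphism R -> K} :=
  match k return {rmorphism R -> scalar_field R k} with
  | real_scalars => idfun : {rmorphism R -> R}
  | complex_scalars => real_complex R : {rmorphism R -> R[i]}
  end.

Lemma embedK : cancel embed (@real_part R k).
Proof. by rewrite /embed; case: k. Qed.

Lemma real_partK (z : K) : 0 <= z -> embed (real_part z) = z.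
Proof.
rewrite /embed; move: z; case: k => //= -[a b].
by rewrite lecE /= => /andP[/eqP-> _].
Qed.

Lemma le_embed : {mono embed : x y / x <= y}.
Proof. by rewrite /embed; case: k => //= x y; rewrite lecE /= eqxx. Qed.

Lemma embed_rnorm (V : normedZmodType K) (v : V) : embed (rnorm v) = `|v|.
Proof. exact: real_partK. Qed.

Lemma rnorm_ge0 (V : normedZmodType K) (v : V) : 0 <= rnorm v.
Proof. by rewrite -le_embed embed_rnorm rmorph0. Qed.

Lemma rnormD (V : normedZmodType K) (v w : V) : rnorm (v + w) <= rnorm v + rnorm w.
Proof. by rewrite -le_embed rmorphD /= !embed_rnorm ler_normD. Qed.

Lemma rnorm0 (V : normedZmodType K) : rnorm (0 : V) = 0.
Proof. by rewrite /rnorm normr0 -[RHS]embedK rmorph0. Qed.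

Lemma rnorm_eq0 (V : normedZmodType K) (v : V) : rnorm v = 0 -> v = 0.
Proof. by move=> v0; apply/eqP; rewrite -normr_eq0 -embed_rnorm v0 rmorph0. Qed.

Lemma rnorm_embed (r : R) : rnorm (embed r) = `|r|.
Proof.
apply: (can_inj embedK); rewrite embed_rnorm.
have [r0|r0] := leP 0 r; first by rewrite !ger0_norm// -(rmorph0 embed) le_embed.
by rewrite !ler0_norm ?(ltW r0) ?rmorphN// -(rmorph0 embed) le_embed ltW.
Qed.

Lemma rnormZ (V : normedModType K) (a : K) (v : V) :
  rnorm (a *: v) = rnorm a * rnorm v.
Proof. by apply: (can_inj embedK); rewrite rmorphM /= !embed_rnorm normrZ. Qed.

Lemma rnormM (a b : K) : rnorm (a * b) = rnorm a * rnorm b.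
Proof. by apply: (can_inj embedK); rewrite rmorphM /= !embed_rnorm normrM. Qed.

Lemma rnorm_sum (V : normedZmodType K) (I : Type) (s : seq I) (F : I -> V) :
  rnorm (\sum_(i <- s) F i) <= \sum_(i <- s) rnorm (F i).
Proof.
rewrite -le_embed embed_rnorm rmorph_sum /=.
by under [leRHS]eq_bigr do rewrite embed_rnorm; exact: ler_norm_sum.
Qed.

Lemma real_part_le_rnorm (z : K) : real_part z <= rnorm z.
Proof.
rewrite /rnorm; move: z; case: k => [z|z] /=; first exact: ler_norm.
have := normc_ge_Re z; rewrite lecE => /andP[_]; apply: le_trans.
exact: ler_norm.
Qed.

(* Equal to 0 at z = 0. *)
Definition unphase (z : K) : K := `|z| / z.

Lemma unphaseM z : unphase z * z = embed (rnorm z).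
Proof.
rewrite /unphase embed_rnorm; have [->|z0] := eqVneq z 0; last by rewrite divfK.
by rewrite mulr0 normr0.
Qed.

Lemma rnorm_unphase_le1 z : rnorm (unphase z) <= 1.
Proof.
rewrite -le_embed embed_rnorm rmorph1 normrM normr_id normfV.
have [->|z0] := eqVneq z 0; first by rewrite normr0 mul0r ler01.
by rewrite divff// normr_eq0.
Qed.

End Scalars.
Arguments embed {R k}.

(** * Norming functionals and the dual unit ball *)

Section NormingFunctional.
Variables (R : realType) (k : scalar_kind) (E : normedModType (scalar_field R k)).
Local Notation K := (scalar_field R k).

(** In the complex case f(x) = u(x) - i u(i x), the classical complexification of a real
    functional. *)
Lemma complexify (u : E -> R) :
  (forall x y, u (x + y) = u x + u y) ->
  (forall t x, u ((embed t : K) *: x) = t * u x) ->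
  exists f : {scalar E}, forall x, real_part (f x) = u x.
Proof.
case: k E u => [|] F u uD uZ.
  have [f fu] := scalar_of_additive_scalable (K := R) uD uZ.
  by exists f => x; rewrite -fu.
pose j : R[i] := 'i%C.
pose g (x : F) : R[i] := (u x +i* - u (j *: x))%C.
have uZC t x : u ((t%:C)%C *: x) = t * u x := uZ t x.
have gD x y : g (x + y) = g x + g y.
  by rewrite /g scalerDr !uD opprD.
have gZ (a : R[i]) x : g (a *: x) = a * g x.
  case: a => r s.
  have axE (y : F) : (r +i* s)%C *: y = (r%:C)%C *: y + (s%:C)%C *: (j *: y).
    rewrite scalerA -scalerDl; congr (_ *: _); rewrite /j /=.
    by apply/eqP; rewrite eq_complex /=; apply/andP; split; apply/eqP; ring.
  have uN y : u (- y) = - u y.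
    by rewrite -scaleN1r -(rmorphN1 (real_complex R)) uZC mulN1r.
  have jj : j *: (j *: x) = - x.
    rewrite scalerA -scaleN1r; congr (_ *: _); rewrite /j.
    by apply/eqP; rewrite eq_complex /=; apply/andP; split; apply/eqP; ring.
  have jaxE : j *: ((r +i* s)%C *: x) = (r%:C)%C *: (j *: x) - (s%:C)%C *: x.
    by rewrite scalerA mulrC -scalerA axE jj scalerN.
  rewrite /g jaxE axE !uD uN !uZC.
  by apply/eqP; rewrite eq_complex /=; apply/andP; split; apply/eqP; ring.
have [f fg] := scalar_of_additive_scalable (K := R[i]) gD gZ.
by exists f => x; rewrite fg.
Qed.

Lemma rnorm_sublinear : sublinear (@embed R k) (@rnorm R k E).
Proof.
by split=> [|t x t0]; [exact: rnormD|rewrite rnormZ rnorm_embed ger0_norm].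
Qed.

Lemma norming_functional (v : E) :
  exists2 f : {scalar E}, forall x, rnorm (f x) <= rnorm x & rnorm (f v) = rnorm v.
Proof.
have [u [uD uZ u_le uv]] := hahn_banach_sublinear v rnorm_sublinear.
have [f fu] := complexify uD uZ.
have f_le x : rnorm (f x) <= rnorm x.
  (* Rotating x by the phase of f(x) makes the value of f real, hence equal to u there, and does not
     increase the norm of x. *)
  rewrite -[rnorm (f x)](@embedK R k) -unphaseM -linearZ_LR /= fu.
  apply: le_trans (u_le _) _; rewrite rnormZ.
  by rewrite ler_piMl ?rnorm_ge0// rnorm_unphase_le1.
exists f => //; apply/le_anti; rewrite f_le/= -uv -fu; exact: real_part_le_rnorm.
Qed.

(** Boundedness makes the supremum in [dual_norm] a genuine upper bound on the unit ball; rescaling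
    a nonzero x to norm 1 spreads it to all vectors. *)
Lemma dual_unit_ballP (f : {scalar E}) :
  dual_unit_ball E f <-> forall x, rnorm (f x) <= rnorm x.
Proof.
split=> [[[M fM] f1] x|f_le]; last first.
  split; first by exists 1 => v; rewrite mul1r.
  apply: ge_sup => [|_ [v /= v1 <-]]; last exact: le_trans (f_le v) v1.
  by exists (rnorm (f 0)), 0 => //=; rewrite rnorm0.
have f_ball v : rnorm v <= 1 -> rnorm (f v) <= 1.
  move=> v1; apply: le_trans f1; apply: ub_le_sup; last by exists v.
  exists `|M| => _ [w /= w1 <-]; apply: le_trans (fM w) _.
  apply: le_trans (ler_norm _) _; rewrite normrM ler_piMr//.
  by rewrite ger0_norm ?rnorm_ge0.
have [/rnorm_eq0->|x0] := eqVneq (rnorm x) 0; first by rewrite linear0 !rnorm0.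
have xp : 0 < rnorm x by rewrite lt_def x0 rnorm_ge0.
have := f_ball (embed (rnorm x)^-1 *: x).
rewrite rnormZ rnorm_embed ger0_norm ?invr_ge0 ?rnorm_ge0// mulVf// => /(_ (lexx _)).
rewrite linearZ_LR /= rnormM rnorm_embed ger0_norm ?invr_ge0 ?rnorm_ge0//.
by rewrite ler_pdivrMl// mulr1.
Qed.

End NormingFunctional.

(** * Hoelder's inequality and its extremal case *)

Section Hoelder.
Variables (R : realType) (k : scalar_kind) (n : nat).
Local Notation K := (scalar_field R k).
Implicit Types (lambda z : 'I_n -> K).

Lemma rnorm_dot_le lambda z :
  rnorm (\sum_(j < n) lambda j * z j) <= \sum_(j < n) rnorm (lambda j) * rnorm (z j).
Proof.
by apply: le_trans (rnorm_sum _ _) _; apply: ler_sum => j _; rewrite rnormM.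
Qed.

Lemma lp_norm_le1 (p : R) lambda : 0 < p ->
  (lp_norm p%:E lambda <= 1) = (\sum_(j < n) rnorm (lambda j) `^ p <= 1).
Proof.
move=> p0; rewrite /lp_norm.
have s0 : 0 <= \sum_(j < n) rnorm (lambda j) `^ p.
  by rewrite sumr_ge0// => j _; exact: powR_ge0.
have one_p : 1 `^ p^-1 = 1 :> R by rewrite powR1.
rewrite -[X in _ `^ _ <= X]one_p; apply/idP/idP => [|?]; last first.
  by rewrite ge0_ler_powR ?nnegrE ?invr_ge0 ?(ltW p0).
by apply: contraTT; rewrite -!ltNge => s1; rewrite gt0_ltr_powR ?nnegrE ?invr_gt0.
Qed.

Lemma lp_norm_powR (q : R) z : 0 < q ->
  lp_norm q%:E z `^ q = \sum_(j < n) rnorm (z j) `^ q.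
Proof.
move=> q0; rewrite /lp_norm -powRrM mulVf ?gt_eqF// powRr1// sumr_ge0// => j _.
exact: powR_ge0.
Qed.

Lemma sum_normalized_powR (q : R) z : 0 < q -> lp_norm q%:E z != 0 ->
  \sum_(j < n) (rnorm (z j) / lp_norm q%:E z) `^ q = 1.
Proof.
move=> q0 S0; have Sge0 : 0 <= lp_norm q%:E z by exact: powR_ge0.
under eq_bigr do rewrite powRM ?rnorm_ge0 ?invr_ge0//.
by rewrite -mulr_suml -lp_norm_powR// -powRM ?invr_ge0// divff// powR1.
Qed.

Lemma lp_hoelder (p q : R) lambda z : 0 < p -> 0 < q -> p^-1 + q^-1 = 1 ->
  lp_norm p%:E lambda <= 1 ->
  rnorm (\sum_(j < n) lambda j * z j) <= lp_norm q%:E z.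
Proof.
move=> p0 q0 pq; rewrite lp_norm_le1// => lambda1.
apply: le_trans (rnorm_dot_le _ _) _; set S := lp_norm _ _.
have S0 : 0 <= S by exact: powR_ge0.
(* Serves the degenerate case S = 0, where it makes every z j vanish. *)
have z_le j : rnorm (z j) <= S.
  rewrite leNgt; apply/negP => Sz.
  have := gt0_ltr_powR q0 S0 (rnorm_ge0 _) Sz.
  rewrite lp_norm_powR// (bigD1 j)//= gtrDl ltNge sumr_ge0// => i _; exact: powR_ge0.
have [S_eq0|S_neq0] := eqVneq S 0.
  rewrite big1 ?S_eq0// => j _.
  suff -> : rnorm (z j) = 0 by rewrite mulr0.
  by apply/le_anti; rewrite rnorm_ge0 -S_eq0 z_le.
have Sp : 0 < S by rewrite lt_def S_neq0.
rewrite -[leRHS]mul1r -ler_pdivrMr// mulr_suml.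
(* Young's inequality, applied to the normalised terms *)
have young j : rnorm (lambda j) * rnorm (z j) / S <=
    rnorm (lambda j) `^ p / p + (rnorm (z j) / S) `^ q / q.
  by rewrite -mulrA conjugate_powR ?divr_ge0 ?rnorm_ge0.
apply: le_trans (ler_sum _ (fun j _ => young j)) _.
rewrite big_split/= -!mulr_suml -pq lerD//.
  by rewrite ler_piMl// invr_ge0 ltW.
rewrite ler_piMl ?invr_ge0 ?(ltW q0)//.
by rewrite sum_normalized_powR.
Qed.

(** The extremal lambda_j has modulus (|z_j| / S)^(q-1) and the phase that makes lambda_j z_j
    nonnegative. It lies in the p-ball because (q - 1) p = q and the numbers (|z_j| / S)^q sum to
    1. *)
Lemma lp_hoelder_extremal (p q : R) z : 1 < p -> 1 < q -> p^-1 + q^-1 = 1 ->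
  exists2 lambda, lp_norm p%:E lambda <= 1 &
    lp_norm q%:E z <= rnorm (\sum_(j < n) lambda j * z j).
Proof.
move=> p1 q1 pq; have p0 := lt_trans ltr01 p1; have q0 := lt_trans ltr01 q1.
set S := lp_norm _ _; have S0 : 0 <= S by exact: powR_ge0.
have qp : (q - 1) * p = q.
  have -> : q - 1 = q * p^-1 by rewrite -[p^-1](addrK q^-1) pq mulrBr mulr1 divff ?gt_eqF.
  by rewrite divfK ?gt_eqF.
have [S_eq0|S_neq0] := eqVneq S 0.
  exists (fun=> 0); last by rewrite S_eq0 rnorm_ge0.
  rewrite lp_norm_le1// big1 ?ler01// => j _.
  by rewrite rnorm0 powR0 ?gt_eqF.
pose w j := (rnorm (z j) / S) `^ (q - 1).
have w0 j : 0 <= w j by exact: powR_ge0.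
have zS0 j : 0 <= rnorm (z j) / S by rewrite divr_ge0 ?rnorm_ge0.
have sum1 := sum_normalized_powR q0 S_neq0.
have lambda_le j : rnorm (embed (w j) * unphase (z j)) <= w j.
  by rewrite rnormM rnorm_embed ger0_norm// ler_piMr// rnorm_unphase_le1.
exists (fun j => embed (w j) * unphase (z j)).
  rewrite lp_norm_le1// -sum1; apply: ler_sum => j _.
  have -> : (rnorm (z j) / S) `^ q = w j `^ p by rewrite /w -powRrM qp.
  have l0 : rnorm (embed (w j) * unphase (z j)) \is Num.nneg.
    by rewrite nnegrE rnorm_ge0.
  have w0' : w j \is Num.nneg by rewrite nnegrE.
  exact: (ge0_ler_powR (ltW p0) l0 w0' (lambda_le j)).
under eq_bigr do rewrite -mulrA unphaseM -rmorphM/=.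
rewrite -rmorph_sum rnorm_embed; apply: le_trans (ler_norm _).
(* S is written as the sum of S (|z_j| / S)^q, whose terms equal w_j |z_j|. *)
rewrite -[leLHS]mul1r -sum1 mulr_suml; apply: ler_sum => j _.
by rewrite -(mulr_powRB1 _ q0)// mulrAC divfK// mulrC.
Qed.

End Hoelder.

(** * Exchange of suprema and the dual formulas *)

(** [sup] depends only on the downward closure, and the two closures coincide. *)
Lemma sup_cofinal (R : realType) (A B : set R) :
  A `<=` down B -> B `<=` down A -> sup A = sup B.
Proof.
move=> AB BA; rewrite -[LHS]sup_down -[RHS]sup_down; congr sup.
apply/seteqP; split=> y /downP[a Xa /le_trans ya]; apply/downP.
  by have /downP[b Bb ab] := AB _ Xa; exists b => //; exact: ya.
by have /downP[b Bb ab] := BA _ Xa; exists b => //; exact: ya.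
Qed.

Section HypoNormDual.
Variables (R : realType) (k : scalar_kind) (E : normedModType (scalar_field R k)).
Variables (n : nat) (x : 'I_n -> E).
Local Notation K := (scalar_field R k).

(** The hypotheses make N the norm dual to that of the lambda-ball. Each lambda is then dominated by
    a norming f, and each f by an extremal lambda. *)
Lemma hypo_norm_dual (q : \bar R) (N : ('I_n -> K) -> R) :
  (forall lambda z, lp_norm (hoelder_conjugate q) lambda <= 1 ->
     rnorm (\sum_(j < n) lambda j * z j) <= N z) ->
  (forall z, exists2 lambda, lp_norm (hoelder_conjugate q) lambda <= 1 &
     N z <= rnorm (\sum_(j < n) lambda j * z j)) ->
  hypo_norm q x = sup [set N (fun j => f (x j)) | f in dual_unit_ball E].
Proof.
have f_sum (f : {scalar E}) lambda :
    f (\sum_(j < n) lambda j *: x j) = \sum_(j < n) lambda j * f (x j).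
  by rewrite linear_sum; apply: eq_bigr => j _; rewrite linearZ_LR.
move=> N_ge N_le; apply: sup_cofinal => [_ [lambda lambda1 <-]|_ [f /dual_unit_ballP f1 <-]].
  have [f f1 fx] := norming_functional (\sum_(j < n) lambda j *: x j).
  apply/downP; exists (N (fun j => f (x j))).
    by exists f => //; apply/dual_unit_ballP.
  by rewrite -fx f_sum N_ge.
have [lambda lambda1 N_lambda] := N_le (fun j => f (x j)).
apply/downP; exists (rnorm (\sum_(j < n) lambda j *: x j)); first by exists lambda.
by apply: le_trans N_lambda _; rewrite -f_sum f1.
Qed.

Lemma hypo_norm_lp (p q : R) : 1 < p -> 1 < q -> p^-1 + q^-1 = 1 ->
  hypo_norm q%:E x =
  sup [set lp_norm q%:E (fun j => f (x j)) | f in dual_unit_ball E].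
Proof.
move=> p1 q1 pq; have p0 := lt_trans ltr01 p1; have q0 := lt_trans ltr01 q1.
have qp : hoelder_conjugate q%:E = p%:E.
  apply/esym/hoelder_conjugateP; rewrite ?ltNyr ?eqe ?gt_eqF//.
  by rewrite !inver !gt_eqF// -EFinD addrC pq.
apply: hypo_norm_dual; rewrite qp.
  by move=> lambda z; exact: lp_hoelder.
by move=> z; exact: lp_hoelder_extremal.
Qed.

Lemma hypo_norm_1 :
  hypo_norm 1%:E x = sup [set \sum_(j < n) rnorm (f (x j)) | f in dual_unit_ball E].
Proof.
apply: (hypo_norm_dual (N := fun z => \sum_(j < n) rnorm (z j))) => [lambda z|z];
  rewrite hoelder_conjugate1 /=.
  move=> lambda1; apply: le_trans (rnorm_dot_le _ _) _.
  apply: ler_sum => j _; rewrite ler_piMl ?rnorm_ge0//.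
  by apply: le_trans lambda1; exact: (le_bigmax _ (fun j => rnorm (lambda j))).
(* These phases turn each term of the sum into |z_j|. *)
exists (fun j => unphase (z j)).
  by apply: bigmax_le => // j _; exact: rnorm_unphase_le1.
under [in leRHS]eq_bigr do rewrite unphaseM.
by rewrite -rmorph_sum rnorm_embed ler_norm.
Qed.

Lemma hypo_norm_pinfty : hypo_norm +oo%E x = max_norm x.
Proof.
have max_ge j : rnorm (x j) <= max_norm x.
  exact: (le_bigmax _ (fun j => rnorm (x j))).
have max_ge0 : 0 <= max_norm x by exact: bigmax_ge_id.
have hypo_le : ubound [set rnorm (\sum_(j < n) lambda j *: x j) |
    lambda in lp_ball (hoelder_conjugate +oo%E)] (max_norm x).
  move=> _ [lambda + <-]; rewrite hoelder_conjugatey /lp_ball /= lp_norm_le1// => lambda1.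
  apply: le_trans (rnorm_sum _ _) _.
  apply: le_trans (ler_piMl max_ge0 lambda1); rewrite mulr_suml.
  apply: ler_sum => j _; rewrite rnormZ powRr1 ?rnorm_ge0//.
  by rewrite ler_wpM2l ?rnorm_ge0.
have hypo_ge lambda : lp_norm 1%:E lambda <= 1 ->
    rnorm (\sum_(j < n) lambda j *: x j) <= hypo_norm +oo%E x.
  by move=> lambda1; apply: ub_le_sup; [exists (max_norm x)|exists lambda].
apply/le_anti/andP; split.
  apply: ge_sup => //; exists (rnorm (\sum_(j < n) (0 : K) *: x j)), (fun=> 0) => //=.
  rewrite hoelder_conjugatey /lp_ball /= lp_norm_le1// big1// => j _.
  by rewrite rnorm0 powRr1.
(* The default 0 of the maximum is bounded using lambda = 0, and each norm of x j using the j-th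
   unit coordinate vector. *)
apply: bigmax_le => [|j _].
  apply: le_trans (rnorm_ge0 (\sum_(j < n) (0 : K) *: x j)) (hypo_ge (fun=> 0) _).
  rewrite lp_norm_le1// big1// => j _.
  by rewrite rnorm0 powRr1.
have := hypo_ge (fun i => (i == j)%:R); rewrite lp_norm_le1//.
rewrite (bigD1 j)//= [X in _ + X]big1 => [|i /negbTE->]; last first.
  by rewrite rnorm0 powRr1.
rewrite (bigD1 j)//= [X in rnorm (_ + X)]big1 => [|i /negbTE->]; last first.
  by rewrite scale0r.
rewrite eqxx scale1r !addr0; apply.
by rewrite -(rmorph1 embed) rnorm_embed normr1 powR1.
Qed.

End HypoNormDual.

Theorem theorem3 (R : realType) (k : scalar_kind)
    (E : normedModType (scalar_field R k))
    (n : nat) (n_ge1 : (1 <= n)%N) (x : 'I_n -> E) :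
  [/\ forall p q : R, 1 < p -> 1 < q -> p^-1 + q^-1 = 1 ->
        hypo_norm q%:E x =
        sup [set (\sum_(j < n) rnorm (f (x j)) `^ q) `^ q^-1 |
              f in dual_unit_ball E],
      hypo_norm 1%:E x =
        sup [set \sum_(j < n) rnorm (f (x j)) | f in dual_unit_ball E],
      hypo_norm +oo%E x = max_norm x
        /\ max_norm x = \big[Num.max/0]_(j < n) rnorm (x j) &
      hypo_euclidean_norm x =
        sup [set Num.sqrt (\sum_(j < n) rnorm (f (x j)) ^+ 2) |
              f in dual_unit_ball E]].
Proof.
split.
- by move=> p q; exact: hypo_norm_lp.
- exact: hypo_norm_1.
- by split=> //; exact: hypo_norm_pinfty.
have two_gt1 : 1 < 2 :> R by rewrite ltr1n.
rewrite /hypo_euclidean_norm (hypo_norm_lp x two_gt1 two_gt1); last first.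
  by rewrite -mulr2n -[_ *+ 2]mulr_natr mulVf.
(* With p = q = 2, the real powers 2 and 1/2 become the square and the square root. *)
congr sup; apply: eq_imagel => f _; rewrite /lp_norm.
under eq_bigr do rewrite powR_mulrn ?rnorm_ge0//.
by rewrite powR12_sqrt// sumr_ge0// => j _; rewrite exprn_ge0// rnorm_ge0.
Qed.
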